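(* Let $\mathbb{K}$ be a field of characteristic $\neq 2$. Define maps $F_n: Cl(n,n)\to M_{2^n}(\mathbb{K})$ recursively by $F_0(a)=(a)$ for $a\in Cl(0,0)=\mathbb{K}$ and, for $n\ge 1$ and $A_{00},A_{01},A_{10},A_{11}\in Cl(n-1,n-1)$, $$F_n(A_{00}+e_{n-1}A_{01}+\tilde e_{n-1}A_{10}+\tilde e_{n-1}e_{n-1}A_{11})=\begin{bmatrix}F_{n-1}(A_{00}+A_{11}) & F_{n-1}(\alpha(A_{01}+A_{10}))\\ F_{n-1}(A_{01}-A_{10}) & F_{n-1}(\alpha(A_{00}-A_{11}))\end{bmatrix}.$$ Then for every $n\ge 0$ the map $F_n$ is an isomorphism of $\mathbb{K}$-algebras. Furthermore, there are algorithms computing, for $n\ge 1$, the $4^n$ entries of the matrix $F_n(a)$ from the $4^n$ blade coefficients of $a\in Cl(n,n)$, and the $4^n$ blade coefficients of $F_n^{-1}(M)$ from the $4^n$ entries of $M\in M_{2^n}(\mathbb{K})$, each using $O(n\cdot 4^n)=O(N\log N)$ operations, where $N=4^n$.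
   Context: $Cl(n,n)$ is the Clifford algebra over $\mathbb{K}$ generated by pairwise anticommuting basis vectors $e_0,\dots,e_{n-1}$ (each squaring to $1$) and $\tilde e_0,\dots,\tilde e_{n-1}$ (each squaring to $-1$); it has dimension $4^n$, with basis the products (blades) of distinct basis vectors, and the blade coefficients of $a$ are its coordinates in this basis. $Cl(n-1,n-1)\subset Cl(n,n)$ is the subalgebra generated by the basis vectors with indices $0,\dots,n-2$. $\alpha$ is the parity automorphism: the algebra automorphism sending every basis vector $v$ to $-v$. An operation means an addition or subtraction of two elements of $\mathbb{K}$, a sign change of an element of $\mathbb{K}$, or a division of an element of $\mathbb{K}$ by $2$, each counted with unit cost; the constant in $O(\cdot)$ is absolute. *)

(* Defs.v *)
From HB Require Import structures.
From mathcomp Require Import all_boot all_order all_algebra.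
From mathcomp Require Import ring.

Set Implicit Arguments.
Unset Strict Implicit.
Unset Printing Implicit Defensive.

Import GRing.Theory.
Local Open Scope ring_scope.

(* The generators of Cl(n,n): (i, false) stands for e_i (square 1) and        *)
(* (i, true) for ~e_i (square -1).                                            *)
Definition gen (n : nat) : Type := ('I_n * bool)%type.
HB.instance Definition _ n := Finite.on (gen n).

(* The factors of a blade are ordered as ~e_(n-1) e_(n-1) ... ~e_0 e_0, and   *)
(* prec x y means that x stands to the left of y. Another order would change  *)
(* each blade, hence each blade coefficient, at most by a sign.               *)
Definition prec n : rel (gen n) := fun x y =>
  (y.1 < x.1)%N || [&& x.1 == y.1, x.2 & ~~ y.2].

Section Signs.
Variable n : nat.
Implicit Types (S T U : {set gen n}) (x y : gen n).

Definition symdiff S T : {set gen n} := (S :\: T) :|: (T :\: S).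

(* The number of transpositions that sort the product of the blades S and T,  *)
(* plus the number of common factors whose square is -1.                      *)
Definition sign_exp S T : nat :=
  #|[set p in setX S T | prec p.2 p.1]| + #|[set x in S :&: T | x.2]|.

Lemma in_symdiff S T x : (x \in symdiff S T) = (x \in S) (+) (x \in T).
Proof. by rewrite !inE; case: (x \in S); case: (x \in T). Qed.

Lemma symdiffK S : involutive (symdiff S).
Proof. by move=> T; apply/setP=> x; rewrite !in_symdiff addbA addbb. Qed.

Lemma symdiffA : associative symdiff.
Proof. by move=> S T U; apply/setP=> x; rewrite !in_symdiff addbA. Qed.

Lemma symdiff0s S : symdiff set0 S = S.
Proof. by apply/setP=> x; rewrite in_symdiff in_set0. Qed.

Lemma symdiffC : commutative symdiff.
Proof. by move=> S T; apply/setP=> x; rewrite !in_symdiff addbC. Qed.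

Lemma symdiffs0 S : symdiff S set0 = S.
Proof. by rewrite symdiffC symdiff0s. Qed.

Lemma symdiffss S : symdiff S S = set0.
Proof. by apply/setP=> x; rewrite in_symdiff addbb in_set0. Qed.

Lemma prec_irr : irreflexive (@prec n).
Proof. by move=> x; rewrite /prec ltnn andbN andbF. Qed.

Lemma prec_trans : transitive (@prec n).
Proof.
move=> [j c] [i b] [k d]; rewrite /prec -!(inj_eq val_inj) /=.
case/orP=> [lt_ji|/and3P[/eqP-> b1 c0]] /orP[lt_kj|/and3P[/eqP<- c1 d0]].
- by rewrite (ltn_trans lt_kj).
- by rewrite lt_ji.
- by rewrite lt_kj.
by rewrite c1 in c0.
Qed.

Lemma symdiff_eq S T U : (symdiff S T == U) = (T == symdiff S U).
Proof. by rewrite -(inj_eq (inv_inj (symdiffK S))) symdiffK. Qed.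

Variable K : nzRingType.

Definition blade_sign S T : K := (-1) ^+ sign_exp S T.

Let w x y : K := (-1) ^+ (prec y x + ((x == y) && x.2))%N.

Lemma blade_signE S T :
  blade_sign S T = \prod_(x in S) \prod_(y in T) w x y.
Proof.
rewrite (eq_bigr (fun x => (-1) ^+ \sum_(y in T)
   (prec y x + ((x == y) && x.2))%N)); last by move=> x _; rewrite prodrXr.
rewrite prodrXr; congr (_ ^+ _); rewrite /sign_exp.
under [RHS]eq_bigr do rewrite big_split /=.
rewrite big_split /=; congr addn.
  rewrite -sum1_card pair_big_dep [LHS]big_mkcond [RHS]big_mkcond /=.
  by apply: eq_bigr => -[x y] _; rewrite !inE /=; case: (x \in S);
     case: (y \in T); case: (prec y x).
rewrite -sum1_card [LHS]big_mkcond [RHS]big_mkcond /=.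
apply: eq_bigr => x _; rewrite !inE.
case: (x \in S) => //=; rewrite big_mkcond (bigD1 x) //= eqxx /=.
rewrite big1 ?addn0; last by move=> y; rewrite eq_sym => /negbTE->; case: ifP.
by case: (x \in T); case: x.2.
Qed.

Lemma wK x y : w x y * w x y = 1.
Proof. by rewrite -exprD addnn -mul2n exprM sqrrN expr1n expr1n. Qed.

Lemma blade_sign0s S : blade_sign set0 S = 1.
Proof. by rewrite blade_signE big_set0. Qed.

Lemma blade_signs0 S : blade_sign S set0 = 1.
Proof. by rewrite blade_signE big1 // => x _; rewrite big_set0. Qed.

End Signs.

Section Cocycle.
Variables (n : nat) (K : comNzRingType).
Implicit Types (S T U : {set gen n}).

Lemma prod_symdiff (f : gen n -> K) S T : (forall x, f x * f x = 1) ->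
  \prod_(x in symdiff S T) f x = (\prod_(x in S) f x) * \prod_(x in T) f x.
Proof.
move=> fK; rewrite [LHS]big_mkcond [X in _ = X * _]big_mkcond.
rewrite [X in _ = _ * X]big_mkcond /= -big_split /=.
apply: eq_bigr => x _; rewrite in_symdiff.
by case: (x \in S); case: (x \in T); rewrite ?mulr1 ?mul1r ?fK.
Qed.

Lemma blade_signDl S T U :
  blade_sign K (symdiff S T) U = blade_sign K S U * blade_sign K T U.
Proof.
rewrite !blade_signE prod_symdiff // => x.
by rewrite -big_split big1 //= => y _; rewrite wK.
Qed.

Lemma blade_signDr S T U :
  blade_sign K S (symdiff T U) = blade_sign K S T * blade_sign K S U.
Proof.
rewrite !blade_signE -big_split /=; apply: eq_bigr => x _.
by rewrite prod_symdiff // => y; rewrite wK.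
Qed.

End Cocycle.

(* A record rather than an alias of {ffun _ -> K}, which has its own          *)
(* pointwise ring structure; the argument lists the blade coefficients.       *)
Variant Clifford (K : Type) (n : nat) : Type :=
  MkClifford of {ffun {set gen n} -> K}.

Definition clifford_val K n (a : Clifford K n) :=
  let: MkClifford g := a in g.

HB.instance Definition _ K n := [isNew for @clifford_val K n].
HB.instance Definition _ (K : eqType) n := [Equality of Clifford K n by <:].
HB.instance Definition _ (K : choiceType) n := [Choice of Clifford K n by <:].

Definition bcoef K n (a : Clifford K n) (S : {set gen n}) : K :=
  clifford_val a S.

Definition of_bcoef K n (f : {set gen n} -> K) : Clifford K n :=
  MkClifford (finfun f).

Lemma bcoefE K n (f : {set gen n} -> K) S : bcoef (of_bcoef f) S = f S.
Proof. by rewrite /bcoef /= ffunE. Qed.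

Lemma bcoefP K n (a b : Clifford K n) : bcoef a =1 bcoef b <-> a = b.
Proof.
split=> [|-> //]; case: a b => [f] [g] eq_fg; congr MkClifford.
exact/ffunP.
Qed.

Section CliffordZmodule.
Variables (K : zmodType) (n : nat).
Implicit Types a b : Clifford K n.

Definition clifford_zero : Clifford K n := of_bcoef (fun=> 0).
Definition clifford_opp a := of_bcoef (fun S => - bcoef a S).
Definition clifford_add a b := of_bcoef (fun S => bcoef a S + bcoef b S).

Fact clifford_addA : associative clifford_add.
Proof. by move=> a b c; apply/bcoefP=> S; rewrite !bcoefE addrA. Qed.
Fact clifford_addC : commutative clifford_add.
Proof. by move=> a b; apply/bcoefP=> S; rewrite !bcoefE addrC. Qed.
Fact clifford_add0 : left_id clifford_zero clifford_add.
Proof. by move=> a; apply/bcoefP=> S; rewrite !bcoefE add0r. Qed.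
Fact clifford_addN : left_inverse clifford_zero clifford_opp clifford_add.
Proof. by move=> a; apply/bcoefP=> S; rewrite !bcoefE addNr. Qed.

HB.instance Definition _ := GRing.isZmodule.Build (Clifford K n)
  clifford_addA clifford_addC clifford_add0 clifford_addN.

Lemma bcoef0 S : bcoef (0 : Clifford K n) S = 0.
Proof. exact: bcoefE. Qed.
Lemma bcoefN a S : bcoef (- a) S = - bcoef a S.
Proof. exact: bcoefE. Qed.
Lemma bcoefD a b S : bcoef (a + b) S = bcoef a S + bcoef b S.
Proof. exact: bcoefE. Qed.
Lemma bcoefB a b S : bcoef (a - b) S = bcoef a S - bcoef b S.
Proof. by rewrite bcoefD bcoefN. Qed.
Lemma bcoef_sum I (r : seq I) (P : pred I) (F : I -> Clifford K n) S :
  bcoef (\sum_(i <- r | P i) F i) S = \sum_(i <- r | P i) bcoef (F i) S.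
Proof. by apply: (big_morph (fun a => bcoef a S)) => [a b|]; rewrite (bcoefD, bcoef0). Qed.

End CliffordZmodule.

Section CliffordAlgebra.
Variables (K : comNzRingType) (n : nat).
Implicit Types (a b c : Clifford K n) (k : K) (S T U : {set gen n}).

Definition clifford_scale k a : Clifford K n := of_bcoef (fun S => k * bcoef a S).

Fact clifford_scaleA k l a :
  clifford_scale k (clifford_scale l a) = clifford_scale (k * l) a.
Proof. by apply/bcoefP=> S; rewrite !bcoefE mulrA. Qed.
Fact clifford_scale1 : left_id 1 clifford_scale.
Proof. by move=> a; apply/bcoefP=> S; rewrite !bcoefE mul1r. Qed.
Fact clifford_scaleDr : right_distributive clifford_scale +%R.
Proof. by move=> k a b; apply/bcoefP=> S; rewrite !(bcoefE, bcoefD) mulrDr. Qed.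
Fact clifford_scaleDl a :
  {morph clifford_scale^~ a : k l / k + l}.
Proof. by move=> k l; apply/bcoefP=> S; rewrite !(bcoefE, bcoefD) mulrDl. Qed.

HB.instance Definition _ := GRing.Zmodule_isLmodule.Build K (Clifford K n)
  clifford_scaleA clifford_scale1 clifford_scaleDr clifford_scaleDl.

Lemma bcoefZ k a S : bcoef (k *: a) S = k * bcoef a S.
Proof. exact: bcoefE. Qed.

Definition blade S : Clifford K n := of_bcoef (fun T => (T == S)%:R).

(* The bilinear extension of                                                  *)
(*   blade S * blade T = blade_sign S T *: blade (symdiff S T).               *)
Definition clifford_mul a b : Clifford K n := of_bcoef (fun U =>
  \sum_S \sum_(T | symdiff S T == U) blade_sign K S T * (bcoef a S * bcoef b T)).

Lemma clifford_mulE a b U : bcoef (clifford_mul a b) U =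
  \sum_S blade_sign K S (symdiff S U) * (bcoef a S * bcoef b (symdiff S U)).
Proof.
rewrite bcoefE; apply: eq_bigr => S _.
rewrite (eq_bigl (xpred1 (symdiff S U))) ?big_pred1_eq // => T.
exact: symdiff_eq.
Qed.

Fact clifford_mulA : associative clifford_mul.
Proof.
move=> a b c; apply/bcoefP=> U; rewrite !clifford_mulE.
under eq_bigr do rewrite clifford_mulE mulr_sumr mulr_sumr.
under [RHS]eq_bigr do rewrite clifford_mulE mulr_suml mulr_sumr.
rewrite [RHS]exchange_big /=; apply: eq_bigr => S _.
rewrite (reindex_inj (inv_inj (symdiffK S))); apply: eq_bigr => T _ /=.
have -> : symdiff (symdiff S T) (symdiff S U) = symdiff T U.
  by apply/setP=> x; rewrite !in_symdiff; do 3 case: (_ \in _).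
have -> : symdiff S U = symdiff (symdiff S T) (symdiff T U).
  by apply/setP=> x; rewrite !in_symdiff; do 3 case: (_ \in _).
rewrite blade_signDr [blade_sign K (symdiff S T) (symdiff T U)]blade_signDl.
set u := blade_sign K S (symdiff T U).
have uK : u * u = 1 by rewrite -expr2 sqrr_sign.
by rewrite -[RHS]mul1r -uK; ring.
Qed.

Fact clifford_mul1l : left_id (blade set0) clifford_mul.
Proof.
move=> a; apply/bcoefP=> U; rewrite clifford_mulE (bigD1 set0) //= bcoefE eqxx.
rewrite blade_sign0s symdiff0s !mul1r big1 ?addr0 // => S /negbTE nS.
by rewrite bcoefE nS mul0r mulr0.
Qed.

Fact clifford_mul1r : right_id (blade set0) clifford_mul.
Proof.
move=> a; apply/bcoefP=> U; rewrite clifford_mulE (bigD1 U) //= symdiffss.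
rewrite bcoefE eqxx blade_signs0 mul1r mulr1 big1 ?addr0 // => S.
by rewrite bcoefE symdiff_eq symdiffs0 eq_sym => /negbTE->; rewrite !mulr0.
Qed.

Fact clifford_mulDl : left_distributive clifford_mul +%R.
Proof.
move=> a b c; apply/bcoefP=> U; rewrite bcoefD !clifford_mulE -big_split /=.
by apply: eq_bigr => S _; rewrite bcoefD mulrDl mulrDr.
Qed.

Fact clifford_mulDr : right_distributive clifford_mul +%R.
Proof.
move=> a b c; apply/bcoefP=> U; rewrite bcoefD !clifford_mulE -big_split /=.
by apply: eq_bigr => S _; rewrite bcoefD -!mulrDr.
Qed.

Fact clifford_1neq0 : blade set0 != 0.
Proof.
apply/eqP=> /bcoefP/(_ set0); rewrite bcoefE bcoef0 eqxx.
by apply/eqP/oner_neq0.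
Qed.

HB.instance Definition _ := GRing.Zmodule_isNzRing.Build (Clifford K n)
  clifford_mulA clifford_mul1l clifford_mul1r clifford_mulDl clifford_mulDr
  clifford_1neq0.

Lemma bcoefM a b U : bcoef (a * b) U =
  \sum_S blade_sign K S (symdiff S U) * (bcoef a S * bcoef b (symdiff S U)).
Proof. exact: clifford_mulE. Qed.

Fact clifford_scaleAl k a b : k *: (a * b) = (k *: a) * b.
Proof.
apply/bcoefP=> U; rewrite bcoefZ !bcoefM mulr_sumr.
by apply: eq_bigr => S _; rewrite bcoefZ; ring.
Qed.
HB.instance Definition _ :=
  GRing.Lmodule_isLalgebra.Build K (Clifford K n) clifford_scaleAl.

Fact clifford_scaleAr k a b : k *: (a * b) = a * (k *: b).
Proof.
apply/bcoefP=> U; rewrite bcoefZ !bcoefM mulr_sumr.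
by apply: eq_bigr => S _; rewrite bcoefZ; ring.
Qed.
HB.instance Definition _ :=
  GRing.Lalgebra_isAlgebra.Build K (Clifford K n) clifford_scaleAr.

Definition gen_vec (x : gen n) : Clifford K n := blade [set x].
Definition evec (i : 'I_n) : Clifford K n := gen_vec (i, false).
Definition tevec (i : 'I_n) : Clifford K n := gen_vec (i, true).

Lemma bcoef_blade S T : bcoef (blade S) T = (T == S)%:R.
Proof. exact: bcoefE. Qed.

Lemma blade0 : blade set0 = 1.
Proof. by []. Qed.

Lemma blade_expand a : a = \sum_S bcoef a S *: blade S.
Proof.
apply/bcoefP=> T; rewrite bcoef_sum (bigD1 T) //= bcoefZ bcoef_blade eqxx mulr1.
rewrite big1 ?addr0 // => S; rewrite bcoefZ bcoef_blade eq_sym => /negbTE->.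
by rewrite mulr0.
Qed.

Lemma bcoef_blade_mul S a U :
  bcoef (blade S * a) U = blade_sign K S (symdiff S U) * bcoef a (symdiff S U).
Proof.
rewrite bcoefM (bigD1 S) //= bcoef_blade eqxx mul1r big1 ?addr0 // => T.
by move=> /negbTE nT; rewrite bcoef_blade nT mul0r mulr0.
Qed.

Lemma bladeM S T : blade S * blade T = blade_sign K S T *: blade (symdiff S T).
Proof.
apply/bcoefP=> U; rewrite bcoef_blade_mul bcoefZ !bcoef_blade symdiff_eq.
have [->|_] := eqVneq U (symdiff S T); last by rewrite !mulr0.
by rewrite symdiffK.
Qed.

Let signE1 (x y : gen n) :
  blade_sign K [set x] [set y] = (-1) ^+ (prec y x + ((x == y) && x.2))%N.
Proof. by rewrite blade_signE !big_set1. Qed.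

Lemma evec_sqr i : evec i ^+ 2 = 1.
Proof.
by rewrite expr2 bladeM symdiffss blade0 signE1 /prec /= ltnn !andbF scale1r.
Qed.

Lemma tevec_sqr i : tevec i ^+ 2 = -1.
Proof.
rewrite expr2 bladeM symdiffss blade0 signE1 /prec /= ltnn !andbF eqxx.
by rewrite expr1 scaleN1r.
Qed.

Lemma gen_vec_anticomm x y : x != y -> gen_vec x * gen_vec y = - (gen_vec y * gen_vec x).
Proof.
move=> nxy; rewrite !bladeM symdiffC -scaleNr; congr (_ *: _).
rewrite !signE1 [y == x]eq_sym (negbTE nxy) !addn0.
move: x y nxy => [i b] [j c]; rewrite /prec /= xpair_eqE -!(inj_eq val_inj) /=.
by case: ltngtP => //= _; case: b; case: c => //=; rewrite expr1 ?opprK.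
Qed.

Lemma blade_prod (s : seq (gen n)) : sorted (@prec n) s ->
  \prod_(x <- s) gen_vec x = blade [set x in s].
Proof.
elim: s => [_|x s IHs /= s_sorted].
  by rewrite big_nil -blade0; congr blade; apply/setP=> x; rewrite !inE.
rewrite big_cons IHs ?(path_sorted s_sorted) // bladeM.
have lt_xs: all (prec x) s by apply: order_path_min s_sorted; apply: prec_trans.
have -> : blade_sign K [set x] [set y in s] = 1.
  rewrite blade_signE big_set1 big1 // => y; rewrite inE => sy.
  have := allP lt_xs _ sy; rewrite /prec; case: x y {sy lt_xs s_sorted} => i b [j c].
  rewrite /= xpair_eqE -!(inj_eq val_inj) /=.
  by case: ltngtP => //= _; case: b; case: c.
rewrite scale1r; congr blade; apply/setP=> y; rewrite in_symdiff !inE.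
have [->|//] := eqVneq y x; rewrite addTb; apply/negP=> /(allP lt_xs).
by rewrite prec_irr.
Qed.

(* The algebra automorphism with v |-> - v on basis vectors (parity_gen). *)
Definition parity a : Clifford K n := of_bcoef (fun S => (-1) ^+ #|S| * bcoef a S).

Lemma bcoef_parity a S : bcoef (parity a) S = (-1) ^+ #|S| * bcoef a S.
Proof. exact: bcoefE. Qed.

Fact parity_is_linear : linear parity.
Proof.
move=> k a b; apply/bcoefP=> S.
by rewrite !(bcoef_parity, bcoefD, bcoefZ); ring.
Qed.
HB.instance Definition _ :=
  GRing.isLinear.Build K (Clifford K n) (Clifford K n) *:%R parity parity_is_linear.

Let card_sign (S : {set gen n}) : (-1) ^+ #|S| = \prod_(x in S) (-1 : K).
Proof. by rewrite prodr_const. Qed.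

Fact parity_is_monoid_morphism : monoid_morphism parity.
Proof.
split.
  apply/bcoefP=> S; rewrite bcoef_parity bcoef_blade.
  by have [->|_] := eqVneq S set0; rewrite ?mulr0 // cards0 mul1r.
move=> a b; apply/bcoefP=> U; rewrite bcoef_parity !bcoefM mulr_sumr.
apply: eq_bigr => S _; rewrite !bcoef_parity.
have -> : (-1) ^+ #|U| = (-1) ^+ #|S| * (-1) ^+ #|symdiff S U| :> K.
  rewrite -{1}[U](symdiffK S) !card_sign prod_symdiff // => _.
  by rewrite mulrNN mulr1.
ring.
Qed.
HB.instance Definition _ := GRing.isMonoidMorphism.Build
  (Clifford K n) (Clifford K n) parity parity_is_monoid_morphism.

Lemma parityK : involutive parity.
Proof.
move=> a; apply/bcoefP=> S.
by rewrite !bcoef_parity mulrA -expr2 sqrr_sign mul1r.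
Qed.

Lemma parity_gen x : parity (gen_vec x) = - gen_vec x.
Proof.
apply/bcoefP=> S; rewrite bcoef_parity bcoefN bcoef_blade.
by have [->|_] := eqVneq S [set x]; rewrite ?mulr0 ?oppr0 // cards1 expr1 mulN1r.
Qed.

End CliffordAlgebra.
Arguments evec : clear implicits.
Arguments tevec : clear implicits.

Definition widen_gen n (x : gen n) : gen n.+1 :=
  (widen_ord (leqnSn n) x.1, x.2).

(* The blade of Cl(n+1,n+1) with lower factors S, preceded by ~e_n when x     *)
(* and by e_n when y.                                                         *)
Definition ext_blade n (x y : bool) (S : {set gen n}) : {set gen n.+1} :=
  [set (ord_max, b) | b : bool & if b then x else y] :|: @widen_gen n @: S.

Section Blades.
Variable n : nat.
Implicit Types (S T : {set gen n}) (x y p q : bool).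

Lemma widen_gen_inj : injective (@widen_gen n).
Proof. by move=> [i b] [j c] [] /val_inj-> ->. Qed.

Lemma widen_gen_neq_max (z : gen n) b : widen_gen z <> (ord_max, b).
Proof.
by move=> [eq_zn _]; have := ltn_ord z.1; rewrite eq_zn ltnn.
Qed.

Lemma gen_max_case (z : gen n.+1) :
  (exists b, z = (ord_max, b)) \/ (exists t, z = widen_gen t).
Proof.
case: z => i b; have [lt_in|] := ltnP i n.
  by right; exists (Ordinal lt_in, b); congr pair; apply: val_inj.
move=> le_ni; left; exists b; congr pair; apply: val_inj => /=.
by apply/eqP; rewrite eqn_leq le_ni -ltnS ltn_ord.
Qed.

Lemma in_ext_max x y S b :
  ((ord_max, b) \in ext_blade x y S) = if b then x else y.
Proof.
rewrite inE; apply/orP/idP.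
  case=> [/imsetP[c]|/imsetP[z _ /esym/widen_gen_neq_max//]].
  by rewrite inE => cP [->].
by move=> bP; left; apply/imsetP; exists b; rewrite // inE.
Qed.

Lemma in_ext_widen x y S z : (widen_gen z \in ext_blade x y S) = (z \in S).
Proof.
rewrite inE (mem_imset _ _ widen_gen_inj); case: imsetP => //=.
by case=> b _ /widen_gen_neq_max.
Qed.

Lemma ext_bladeP (U V : {set gen n.+1}) :
  (forall b, ((ord_max, b) \in U) = ((ord_max, b) \in V)) ->
  (forall z : gen n, (widen_gen z \in U) = (widen_gen z \in V)) -> U = V.
Proof.
move=> eq_max eq_low; apply/setP=> z.
by case: (gen_max_case z) => [] [t ->].
Qed.

Lemma ext_blade_inj x y : injective (ext_blade x y : {set gen n} -> _).
Proof.
by move=> S T /setP eST; apply/setP=> z; have := eST (widen_gen z);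
  rewrite !in_ext_widen.
Qed.

Lemma ext_blade_surj (U : {set gen n.+1}) :
  exists x y S, U = ext_blade x y S.
Proof.
exists ((ord_max, true) \in U), ((ord_max, false) \in U).
exists (@widen_gen n @^-1: U); apply: ext_bladeP => [b|z].
  by rewrite in_ext_max; case: b.
by rewrite in_ext_widen inE.
Qed.

Lemma ext_blade00 S : ext_blade false false S = @widen_gen n @: S.
Proof.
rewrite /ext_blade [X in X :|: _](_ : _ = set0) ?set0U //.
by apply/setP=> z; rewrite in_set0; apply/imsetP=> -[b]; rewrite inE if_same.
Qed.

Lemma symdiff_ext x y p q S T :
  symdiff (ext_blade x y S) (ext_blade p q T) =
  ext_blade (x (+) p) (y (+) q) (symdiff S T).
Proof.
by apply: ext_bladeP => [[]|z]; rewrite in_symdiff ?in_ext_max // !in_ext_widen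
  in_symdiff.
Qed.

End Blades.

Section Embedding.
Variables (K : comNzRingType) (n : nat).
Implicit Types (a b : Clifford K n) (S T : {set gen n}).

Definition widen_clifford a : Clifford K n.+1 :=
  \sum_S bcoef a S *: blade K (@widen_gen n @: S).

Lemma bcoef_widen a x y S :
  bcoef (widen_clifford a) (ext_blade x y S) = if x || y then 0 else bcoef a S.
Proof.
rewrite bcoef_sum (bigD1 S) //= big1 ?addr0 => [|T /negbTE nTS].
  rewrite bcoefZ bcoef_blade -ext_blade00; case: eqP => [/setP eS|].
    have := eS (ord_max, true); have := eS (ord_max, false).
    by rewrite !in_ext_max => -> ->; rewrite mulr1.
  by case: x y => [] [] //; rewrite mulr0.
rewrite bcoefZ bcoef_blade -ext_blade00; case: eqP => [/setP eS|]; last by rewrite mulr0.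
case/eqP: nTS; apply/setP=> z.
by have := eS (widen_gen z); rewrite !in_ext_widen.
Qed.

Fact widen_clifford_is_linear : linear widen_clifford.
Proof.
move=> k a b; rewrite scaler_sumr -big_split /=; apply: eq_bigr => S _.
by rewrite bcoefD bcoefZ scalerDl scalerA.
Qed.
HB.instance Definition _ := GRing.isLinear.Build K (Clifford K n)
  (Clifford K n.+1) *:%R widen_clifford widen_clifford_is_linear.

Lemma widen_blade S : widen_clifford (blade K S) = blade K (@widen_gen n @: S).
Proof.
rewrite /widen_clifford (bigD1 S) //= bcoef_blade eqxx scale1r big1 ?addr0 //.
by move=> T /negbTE nTS; rewrite bcoef_blade nTS scale0r.
Qed.

Lemma blade_sign_widen S T :
  blade_sign K (@widen_gen n @: S) (@widen_gen n @: T) = blade_sign K S T.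
Proof.
rewrite !blade_signE big_imset /=; last by move=> ? ? _ _ /widen_gen_inj.
apply: eq_bigr => x _; rewrite big_imset /=; last by move=> ? ? _ _ /widen_gen_inj.
by apply: eq_bigr => y _; rewrite (inj_eq (@widen_gen_inj n)).
Qed.

Fact widen_clifford_is_monoid_morphism : monoid_morphism widen_clifford.
Proof.
split; first by rewrite -blade0 widen_blade imset0.
move=> a b; rewrite [a]blade_expand [b]blade_expand mulr_suml !linear_sum.
rewrite mulr_suml; apply: eq_bigr => S _; rewrite !mulr_sumr linear_sum.
apply: eq_bigr => T _; rewrite !linearZ /= -!scalerAl -!scalerAr !linearZ /=.
rewrite !scalerA [bcoef b T * _]mulrC; congr (_ *: _).
rewrite bladeM linearZ /= !widen_blade bladeM.
by rewrite blade_sign_widen -!ext_blade00 symdiff_ext.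
Qed.
HB.instance Definition _ := GRing.isMonoidMorphism.Build
  (Clifford K n) (Clifford K n.+1) widen_clifford
  widen_clifford_is_monoid_morphism.

Lemma widen_clifford_inj : injective widen_clifford.
Proof.
move=> a b eq_ab; apply/bcoefP=> S.
have /bcoefP/(_ (ext_blade false false S)) := eq_ab.
by rewrite !bcoef_widen.
Qed.

Lemma widen_clifford_gen (x : gen n) :
  widen_clifford (gen_vec K x) = gen_vec K (widen_gen x).
Proof. by rewrite widen_blade imset_set1. Qed.

(* part false false a, part false true a, part true false a, part true true a *)
(* are the components A_00, A_01, A_10, A_11 of                               *)
(*   a = A_00 + e_n A_01 + ~e_n A_10 + ~e_n e_n A_11.                         *)
Definition part (x y : bool) (a : Clifford K n.+1) : Clifford K n :=
  of_bcoef (fun S => bcoef a (ext_blade x y S)).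

Definition assemble (A00 A01 A10 A11 : Clifford K n) : Clifford K n.+1 :=
  widen_clifford A00 + evec K n.+1 ord_max * widen_clifford A01 +
  tevec K n.+1 ord_max * widen_clifford A10 +
  tevec K n.+1 ord_max * evec K n.+1 ord_max * widen_clifford A11.

Lemma ext_bladeE x y :
  blade K (ext_blade x y (set0 : {set gen n})) =
  (if x then tevec K n.+1 ord_max else 1) *
  (if y then evec K n.+1 ord_max else 1).
Proof.
have maxE c : ext_blade c (~~ c) (set0 : {set gen n}) = [set (ord_max, c)].
  apply: ext_bladeP => [b|z]; rewrite ?in_ext_max ?in_ext_widen !inE.
    by rewrite xpair_eqE eqxx; case: b; case: c.
  by apply/esym/eqP/widen_gen_neq_max.
case: x y => [] [].
- rewrite [RHS]bladeM -(maxE true) -(maxE false) symdiff_ext symdiffss !maxE.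
  rewrite blade_signE !big_set1 /prec /= ltnn /= andbF /=.
  by rewrite xpair_eqE andbF scale1r.
- by rewrite mulr1 (maxE true).
- by rewrite mul1r (maxE false).
by rewrite mul1r ext_blade00 imset0.
Qed.

Lemma blade_sign_ext x y S :
  blade_sign K (ext_blade x y (set0 : {set gen n}))
    (ext_blade false false S) = 1.
Proof.
rewrite [ext_blade false false S]ext_blade00 blade_signE big1 // => u; rewrite /ext_blade imset0 setU0.
case/imsetP=> b _ ->; rewrite big1 // => v /imsetP[z _ ->] /=.
have /eqP/negbTE nz := @widen_gen_neq_max n z b.
rewrite [_ == widen_gen z]eq_sym nz /prec /= -(inj_eq val_inj) /=.
by have := ltn_ord z.1; case: ltngtP.
Qed.

Lemma part_blade x y p q A :
  part x y (blade K (ext_blade p q (set0 : {set gen n})) * widen_clifford A) =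
  if (x == p) && (y == q) then A else 0.
Proof.
apply/bcoefP=> S; rewrite bcoefE bcoef_blade_mul symdiff_ext symdiff0s.
rewrite bcoef_widen; case: x p => [] []; case: y q => [] [] //=;
by rewrite ?mulr0 ?bcoef0 // blade_sign_ext mul1r.
Qed.

Lemma partD x y : {morph part x y : a b / a + b}.
Proof. by move=> a b; apply/bcoefP=> S; rewrite !(bcoefE, bcoefD). Qed.

Lemma part_assemble x y (A : bool -> bool -> Clifford K n) :
  part x y (assemble (A false false) (A false true) (A true false) (A true true))
  = A x y.
Proof.
rewrite /assemble -[widen_clifford (A false false)]mul1r.
have /= e00 := ext_bladeE false false; have /= e01 := ext_bladeE false true.
have /= e10 := ext_bladeE true false; have /= e11 := ext_bladeE true true.
rewrite mulr1 in e00 *; rewrite mul1r in e01; rewrite mulr1 in e10.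
rewrite -e00 -e11 -e01 -e10 !partD !part_blade.
by case: x; case: y; rewrite /= ?addr0 ?add0r.
Qed.

Lemma assemble_part (a : Clifford K n.+1) : a =
  assemble (part false false a) (part false true a)
           (part true false a) (part true true a).
Proof.
apply/bcoefP=> U; have [x [y [S ->]]] := ext_blade_surj U.
have /bcoefP/(_ S) := part_assemble x y (fun x y => part x y a).
by rewrite !bcoefE => ->.
Qed.

End Embedding.

Fact pow2_double n : (2 ^ n + 2 ^ n = 2 ^ n.+1)%N.
Proof. by rewrite addnn -mul2n expnS. Qed.

Definition block_pow2 (K : Type) n (M00 M01 M10 M11 : 'M[K]_(2 ^ n)) :
    'M[K]_(2 ^ n.+1) :=
  castmx (pow2_double n, pow2_double n) (block_mx M00 M01 M10 M11).

(* fmapS below is the recursion on a = assemble A00 A01 A10 A11.              *)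
Fixpoint fmap (K : comNzRingType) (n : nat) : Clifford K n -> 'M[K]_(2 ^ n) :=
  match n with
  | 0 => fun a => const_mx (bcoef a set0)
  | m.+1 => fun a =>
    let A00 := part false false a in let A01 := part false true a in
    let A10 := part true false a in let A11 := part true true a in
    block_pow2 (fmap (A00 + A11)) (fmap (parity (A01 + A10)))
               (fmap (A01 - A10)) (fmap (parity (A00 - A11)))
  end.
Arguments fmap : clear implicits.

Lemma clifford0_scalar (K : comNzRingType) (a : Clifford K 0) :
  a = (bcoef a set0)%:A.
Proof.
apply/bcoefP=> S; have -> : S = set0 by apply/setP=> -[[]].
by rewrite bcoefZ bcoef_blade eqxx mulr1.
Qed.

Lemma fmap0 (K : comNzRingType) (k : K) : fmap K 0 k%:A = const_mx k.
Proof. by rewrite /= bcoefZ bcoef_blade eqxx mulr1. Qed.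

Lemma fmapS (K : comNzRingType) n (A00 A01 A10 A11 : Clifford K n) :
  fmap K n.+1 (assemble A00 A01 A10 A11) =
  block_pow2 (fmap K n (A00 + A11)) (fmap K n (parity (A01 + A10)))
             (fmap K n (A01 - A10)) (fmap K n (parity (A00 - A11))).
Proof.
pose A (x y : bool) := if x then if y then A11 else A10
                       else if y then A01 else A00.
by rewrite /= !(part_assemble _ _ A).
Qed.

(* An operand is an input or the result of an earlier operation, the results  *)
(* being numbered from 0 in the order of computation. There are no constants. *)
Variant operand (I : Type) := Input of I | Result of nat.

Variant operation (I : Type) :=
| Add of operand I & operand I
| Sub of operand I & operand I
| Neg of operand I
| Half of operand I.

Record program (I J : Type) := Program {
  operations : seq (operation I);
  output : J -> operand I
}.

Section Programs.
Variables I J : Type.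
Implicit Types (o : operand I) (op : operation I) (P : program I J).

Definition operand_ok (t : nat) o : bool :=
  if o is Result k then (k < t)%N else true.

Definition operation_ok (t : nat) op : bool :=
  match op with
  | Add o1 o2 | Sub o1 o2 => operand_ok t o1 && operand_ok t o2
  | Neg o | Half o => operand_ok t o
  end.

Fixpoint operations_ok (t : nat) (s : seq (operation I)) : bool :=
  if s is op :: s' then operation_ok t op && operations_ok t.+1 s' else true.

Definition cost P : nat := size (operations P).

(* Every operand used, output included, has been computed before its use.     *)
Definition well_formed P : Prop :=
  operations_ok 0 (operations P) /\
  forall j, operand_ok (cost P) (output P j).

Variables (K : fieldType) (x : I -> K).

Definition operand_val (r : seq K) o : K :=
  match o with Input i => x i | Result k => r`_k end.

Definition operation_val (r : seq K) op : K :=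
  match op with
  | Add o1 o2 => operand_val r o1 + operand_val r o2
  | Sub o1 o2 => operand_val r o1 - operand_val r o2
  | Neg o => - operand_val r o
  | Half o => operand_val r o / 2%:R
  end.

Definition results (s : seq (operation I)) : seq K :=
  foldl (fun r op => rcons r (operation_val r op)) [::] s.

Definition run P (j : J) : K := operand_val (results (operations P)) (output P j).

End Programs.

(* Main.v *)
Require Import Defs.
From HB Require Import structures.
From mathcomp Require Import all_boot all_order all_algebra.
From mathcomp Require Import ring zify.

(* Writing X' for parity X and moving top factors to the left, the product of *)
(* two elements of Cl(n+1,n+1) has components                                 *)
(*   00: A00 B00 + A01' B01 - A10' B10 + A11 B11, and similarly for the rest, *)
(* so the recursion is multiplicative blockwise as soon as F_n is. Its four   *)
(* argument combinations are sums and differences, inverted by halving. As a  *)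
(* program, each level costs one butterfly, one sign pass (and one halving    *)
(* pass for the inverse) on 4^(n+1) values plus four recursive calls, hence   *)
(* T(n+1) <= 4 T(n) + 3 * 4^(n+1) and T(n) <= 3 n 4^n.                        *)

(** A lower element A becomes the block diagonal matrix of F(A) and F(A'), where A' is the parity
    image of A, while the top e and ~e become block antidiagonal matrices that realise Cl(1,1) as 2
    x 2 matrices. The parity in the second block makes the top vectors anticommute with odd lower
    elements, so products agree. [part_mul] gives the components of a product, and
    [fmap_is_monoid_morphism] compares them with block multiplication. Away from characteristic 2,
    [half_sum_diff] recovers the components from the blocks, which makes [fmap_inv] a two-sided
    inverse ([fmap_invK], [fmapK]). For the cost, straight-line programs compose with additive cost
    ([computable_comp], [computable_family]), and both transforms are pipelines of linear-size
    passes around four recursive calls ([computable_fmap], [computable_fmap_inv]). *)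

Set Implicit Arguments.
Unset Strict Implicit.
Unset Printing Implicit Defensive.

Import GRing.Theory.
Local Open Scope ring_scope.

(** * Block matrices of size a power of 2 *)

Section BlockMatrices.
Variables (K : comNzRingType) (n : nat).
Implicit Types M N : 'M[K]_(2 ^ n).

Lemma block_pow2_linear (k : K) M00 M01 M10 M11 N00 N01 N10 N11 :
  block_pow2 (k *: M00 + N00) (k *: M01 + N01) (k *: M10 + N10) (k *: M11 + N11)
  = k *: block_pow2 M00 M01 M10 M11 + block_pow2 N00 N01 N10 N11.
Proof.
rewrite /block_pow2 -add_block_mx -scale_block_mx.
by case: _ / (pow2_double n); rewrite !castmx_id.
Qed.

Lemma block_pow2_mul M00 M01 M10 M11 N00 N01 N10 N11 :
  block_pow2 M00 M01 M10 M11 * block_pow2 N00 N01 N10 N11 =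
  block_pow2 (M00 * N00 + M01 * N10) (M00 * N01 + M01 * N11)
             (M10 * N00 + M11 * N10) (M10 * N01 + M11 * N11).
Proof.
(* Ring products are exposed as [*m] so that [mulmx_block] matches; eliminating [pow2_double n] then
   turns every cast into an identity. *)
rewrite /block_pow2 -[RHS]/(castmx _ (block_mx (_ *m _ + _ *m _)
  (_ *m _ + _ *m _) (_ *m _ + _ *m _) (_ *m _ + _ *m _))) -mulmx_block.
by case: _ / (pow2_double n); rewrite !castmx_id.
Qed.

Lemma block_pow2_1 : block_pow2 1 0 0 1 = 1 :> 'M[K]_(2 ^ n.+1).
Proof.
rewrite /block_pow2 -[block_mx _ _ _ _]/(block_mx 1%:M 0 0 1%:M).
rewrite -scalar_mx_block -[RHS]/(1%:M).
by case: _ / (pow2_double n); rewrite castmx_id.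
Qed.

Definition half_index (b : bool) (i : 'I_(2 ^ n)) : 'I_(2 ^ n.+1) :=
  cast_ord (pow2_double n) (if b then rshift _ i else lshift _ i).

Definition index_half (i : 'I_(2 ^ n.+1)) : bool * 'I_(2 ^ n) :=
  match split (cast_ord (esym (pow2_double n)) i) with
  | inl j => (false, j)
  | inr j => (true, j)
  end.

Lemma index_halfK i : half_index (index_half i).1 (index_half i).2 = i.
Proof.
rewrite /index_half /half_index -[RHS](cast_ordKV (pow2_double n)).
by congr cast_ord; rewrite -[RHS]splitK; case: split.
Qed.

Definition mx_quarter (b c : bool) (M : 'M[K]_(2 ^ n.+1)) : 'M[K]_(2 ^ n) :=
  \matrix_(i, j) M (half_index b i) (half_index c j).

Lemma block_pow2_half (M : bool -> bool -> 'M[K]_(2 ^ n)) b c i j :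
  block_pow2 (M false false) (M false true) (M true false) (M true true)
    (half_index b i) (half_index c j) = M b c i j.
Proof.
rewrite castmxE !cast_ordK.
by case: b; case: c; rewrite (block_mxEul, block_mxEur, block_mxEdl, block_mxEdr).
Qed.

Lemma block_pow2E M00 M01 M10 M11 i j :
  block_pow2 M00 M01 M10 M11 i j =
  (if (index_half i).1 then if (index_half j).1 then M11 else M10
   else if (index_half j).1 then M01 else M00)
    (index_half i).2 (index_half j).2.
Proof.
rewrite -{1}[i]index_halfK -{1}[j]index_halfK.
exact: (block_pow2_half (fun b c => if b then if c then M11 else M10
                                    else if c then M01 else M00)).
Qed.

Lemma quarter_block_pow2 (M : bool -> bool -> 'M[K]_(2 ^ n)) b c :
  mx_quarter b c (block_pow2 (M false false) (M false true) (M true false)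
    (M true true)) = M b c.
Proof. by apply/matrixP=> i j; rewrite mxE block_pow2_half. Qed.

Lemma block_pow2_quarter (M : 'M[K]_(2 ^ n.+1)) :
  block_pow2 (mx_quarter false false M) (mx_quarter false true M)
             (mx_quarter true false M) (mx_quarter true true M) = M.
Proof.
apply/matrixP=> i j; rewrite -[i]index_halfK -[j]index_halfK.
by rewrite (block_pow2_half (fun b c => mx_quarter b c M)) mxE.
Qed.

End BlockMatrices.

(** * Components of a product in Cl(n+1,n+1) *)

Section Parts.
Variables (K : comNzRingType) (n : nat).
Implicit Types a b : Clifford K n.+1.

Lemma part_is_linear x y : linear (@part K n x y).
Proof. by move=> k a b; apply/bcoefP=> S; rewrite !(bcoefE, bcoefD, bcoefZ). Qed.

HB.instance Definition _ x y := GRing.isLinear.Build K (Clifford K n.+1)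
  (Clifford K n) *:%R (part x y) (part_is_linear x y).

Lemma bcoef_assemble (A00 A01 A10 A11 : Clifford K n) x y S :
  bcoef (assemble A00 A01 A10 A11) (ext_blade x y S) =
  bcoef (if x then if y then A11 else A10 else if y then A01 else A00) S.
Proof.
pose A (x y : bool) := if x then if y then A11 else A10
                       else if y then A01 else A00.
by rewrite -[RHS]/(bcoef (A x y) S) -(part_assemble x y A) [RHS]bcoefE.
Qed.

Lemma ext_blade_decomp x y (S : {set gen n}) :
  ext_blade x y S = symdiff (ext_blade x y set0) (ext_blade false false S).
Proof. by rewrite symdiff_ext symdiff0s !addbF. Qed.

Definition unext_blade (U : {set gen n.+1}) : bool * bool * {set gen n} :=
  ((ord_max, true) \in U, (ord_max, false) \in U, @widen_gen n @^-1: U).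

Lemma ext_bladeK x y S : unext_blade (ext_blade x y S) = (x, y, S).
Proof.
rewrite /unext_blade !in_ext_max; congr pair.
by apply/setP=> z; rewrite inE in_ext_widen.
Qed.

Lemma unext_bladeK U :
  ext_blade (unext_blade U).1.1 (unext_blade U).1.2 (unext_blade U).2 = U.
Proof. by have [x [y [S ->]]] := ext_blade_surj U; rewrite ext_bladeK. Qed.

(** Each top factor crosses all of [S], giving #|S| transpositions; with both top factors present
    the signs cancel, hence the exclusive or. *)
Lemma blade_sign_low_top (S : {set gen n}) x y :
  blade_sign K (ext_blade false false S) (ext_blade x y set0) =
  (-1) ^+ ((x (+) y) * #|S|)%N.
Proof.
rewrite ext_blade00 blade_signE big_imset /=; last by move=> ? ? _ _ /widen_gen_inj.
rewrite exprM -prodr_const; apply: eq_bigr => z _.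
have lt_max c : (prec ((ord_max, c) : gen n.+1) (widen_gen z) +
    ((widen_gen z == (ord_max, c)) && z.2) = 1)%N.
  have /eqP/negbTE-> := @widen_gen_neq_max n z c.
  by rewrite /prec /= ltn_ord.
rewrite /ext_blade imset0 setU0 big_imset /=; last by move=> ? ? _ _ [].
under eq_bigr do rewrite lt_max expr1.
rewrite big_mkcond big_bool !inE /=.
by case: x; case: y; rewrite /= ?mulN1r ?opprK ?mulr1 ?mul1r ?expr0 ?expr1.
Qed.

(** The second ~e, if present, crosses the first e (term [y && p]) and may meet the first ~e, whose
    square is -1 (term [x && p]); e squares to 1 and adds nothing. *)
Lemma blade_sign_top x y p q :
  blade_sign K (ext_blade x y (set0 : {set gen n})) (ext_blade p q set0) =
  (-1) ^+ ((x && p) + (y && p))%N.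
Proof.
have top u v : ext_blade u v (set0 : {set gen n}) =
    [set (ord_max, b) | b : bool & if b then u else v].
  by rewrite /ext_blade imset0 setU0.
rewrite !top blade_signE big_imset /=; last by move=> ? ? _ _ [].
under eq_bigr do (rewrite big_imset /=; last by move=> ? ? _ _ []).
rewrite big_mkcond big_bool !inE /=.
do 2 rewrite [in LHS]big_mkcond big_bool !inE /=.
rewrite /prec /= !xpair_eqE !ltnn !eqxx /=.
by case: x; case: y; case: p; case: q; rewrite /= ?expr0 ?expr1; ring.
Qed.

Lemma big_ext_blade (F : {set gen n.+1} -> K) :
  \sum_U F U = \sum_x \sum_y \sum_S F (ext_blade x y S).
Proof.
rewrite pair_big pair_big /=.
rewrite (reindex (fun t : bool * bool * {set gen n} => ext_blade t.1.1 t.1.2 t.2)) //.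
exists unext_blade => [[[x y] S]|U] _; [exact: ext_bladeK | exact: unext_bladeK].
Qed.

(* Moving the top factors of the second term leftwards past the lower factors *)
(* of the first applies parity to the latter once per factor.                 *)
Lemma part_mul x y a b : part x y (a * b) = \sum_p \sum_q
  (-1) ^+ ((p && (x (+) p)) + (q && (x (+) p)))%N *:
  (iter ((x (+) p) (+) (y (+) q)) (@parity K n) (part p q a)
   * part (x (+) p) (y (+) q) b).
Proof.
apply/bcoefP=> S; rewrite bcoefE bcoefM big_ext_blade !bcoef_sum.
apply: eq_bigr => p _; rewrite bcoef_sum; apply: eq_bigr => q _.
rewrite bcoefZ bcoefM mulr_sumr; apply: eq_bigr => T _.
rewrite symdiff_ext !bcoefE [p (+) x]addbC [q (+) y]addbC.
set u := x (+) p; set v := y (+) q; move: (symdiff T S) => W.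
(* Bimultiplicativity splits the sign into four: top-top is the scalar, top-low is 1, low-top is the
   parity, and low-low is the sign in Cl(n,n). *)
rewrite ext_blade_decomp [ext_blade u v _]ext_blade_decomp.
rewrite blade_signDl !blade_signDr blade_sign_top blade_sign_ext blade_sign_low_top.
rewrite !ext_blade00 blade_sign_widen -!ext_blade00 -!ext_blade_decomp.
by case: (u (+) v); rewrite /= ?bcoefE ?mul1n ?mul0n ?expr0; ring.
Qed.

End Parts.

(** * F_n is a morphism of algebras *)

Section FmapMorphism.
Variable K : comNzRingType.

Lemma fmap_is_linear n : linear (fmap K n).
Proof.
elim: n => [|n IHn] k a b.
  by apply/matrixP=> i j; rewrite !mxE bcoefD bcoefZ.
rewrite /= -block_pow2_linear -!IHn !linearP /=.
congr block_pow2; congr (fmap K n _); apply/bcoefP=> S;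
  rewrite ?bcoef_parity !(bcoefD, bcoefN, bcoefZ, bcoef_parity); ring.
Qed.

HB.instance Definition _ n := GRing.isLinear.Build K (Clifford K n)
  'M[K]_(2 ^ n)%type *:%R (fmap K n) (@fmap_is_linear n).

Lemma part1 n x y : part x y (1 : Clifford K n.+1) = if x || y then 0 else 1.
Proof.
have := part_blade x y false false (1 : Clifford K n).
rewrite ext_blade00 imset0 rmorph1 blade0 mulr1 => ->.
by case: x; case: y.
Qed.

Lemma fmap_is_monoid_morphism n : monoid_morphism (fmap K n).
Proof.
elim: n => [|n [IH1 IHM]].
  split; first by apply/matrixP=> i j; rewrite !mxE !ord1 bcoefE eqxx.
  move=> a b; apply/matrixP=> i j; rewrite !mxE big_ord1 !mxE.
  rewrite [a]clifford0_scalar [b]clifford0_scalar -scalerAl mul1r.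
  by rewrite !(bcoefZ, bcoefE) eqxx !mulr1.
split.
  by rewrite /= !part1 /= addr0 subr0 addr0 subr0 rmorph1 IH1 !linear0 block_pow2_1.
move=> a b; rewrite /= block_pow2_mul -!IHM -!linearD !part_mul.
rewrite !big_bool /= !(expr0, expr1, scale1r, expr2, mulrNN, mulr1, scaleN1r).
(* With [fmap K n] pulled out of each block, an identity in Cl(n,n) remains; on coefficients, [ring]
   sees products of components as atoms, so their noncommutativity is respected. *)
congr block_pow2; congr (fmap K n _); apply/bcoefP=> S;
  rewrite ?(rmorphD, rmorphB, rmorphM, rmorphN, parityK) /= ?parityK
    ?(mulrDl, mulrDr, mulNr, mulrN) !(bcoefD, bcoefN); ring.
Qed.

End FmapMorphism.

(** * The inverse of F_n *)

Fixpoint fmap_inv (K : fieldType) (n : nat) : 'M[K]_(2 ^ n) -> Clifford K n :=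
  match n with
  | 0 => fun M => of_bcoef (fun=> M ord0 ord0)
  | m.+1 => fun M =>
    let P := fmap_inv (mx_quarter false false M) in
    let Q := parity (fmap_inv (mx_quarter false true M)) in
    let R := fmap_inv (mx_quarter true false M) in
    let S := parity (fmap_inv (mx_quarter true true M)) in
    assemble (2%:R^-1 *: (P + S)) (2%:R^-1 *: (Q + R))
             (2%:R^-1 *: (Q - R)) (2%:R^-1 *: (P - S))
  end.
Arguments fmap_inv : clear implicits.

Section FmapInverse.
Variable K : fieldType.
Hypothesis char2 : 2%N \notin [pchar K].

Let two_neq0 : 2%:R != 0 :> K.
Proof. by move: char2; rewrite inE. Qed.

(** This is where 2 must be invertible. A pair of equations, so that [rewrite] uses both as one
    rule. *)
Lemma half_sum_diff (V : lmodType K) (u v : V) :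
  (2%:R^-1 *: ((u + v) + (u - v)) = u) * (2%:R^-1 *: ((u + v) - (u - v)) = v).
Proof.
split; first by rewrite addrACA subrr addr0 -mulr2n -scaler_nat
    scalerA mulVf ?scale1r.
by rewrite opprB addrC addrA subrK -mulr2n -scaler_nat scalerA mulVf ?scale1r.
Qed.

Lemma fmap_invK n : cancel (fmap_inv K n) (fmap K n).
Proof.
elim: n => [|n IHn] M.
  by apply/matrixP=> i j; rewrite !mxE bcoefE !ord1.
by rewrite /fmap_inv -/(fmap_inv K n) fmapS -!scalerDr -!scalerBr
  !half_sum_diff !parityK !IHn block_pow2_quarter.
Qed.

Lemma fmapK n : cancel (fmap K n) (fmap_inv K n).
Proof.
elim: n => [|n IHn] a.
  apply/bcoefP=> S; have -> : S = set0 by apply/setP=> -[[]].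
  by rewrite bcoefE mxE.
rewrite /fmap_inv -/(fmap_inv K n) /fmap -/(fmap K n).
set Ms := fun b c : bool =>
  if b then
    if c then fmap K n (parity (part false false a - part true true a))
    else fmap K n (part false true a - part true false a)
  else if c then fmap K n (parity (part false true a + part true false a))
  else fmap K n (part false false a + part true true a).
rewrite !(quarter_block_pow2 Ms) /Ms !IHn !parityK.
by rewrite !half_sum_diff -assemble_part.
Qed.

Lemma fmap_bij n : bijective (fmap K n).
Proof. exact: Bijective (@fmapK n) (@fmap_invK n). Qed.

End FmapInverse.

(** * Evaluation and concatenation of straight-line programs *)

Section Results.
Variables (K : fieldType) (I : Type).
Implicit Types (s : seq (operation I)).

Lemma operations_ok_cat t s s' :
  operations_ok t (s ++ s') = operations_ok t s && operations_ok (t + size s) s'.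
Proof.
elim: s t => [|op s IHs] t /=; first by rewrite addn0.
by rewrite IHs addSnnS andbA.
Qed.

Lemma operand_ok_leq t t' (o : operand I) :
  (t <= t')%N -> operand_ok t o -> operand_ok t' o.
Proof. by case: o => //= k le_t lt_k; apply: leq_trans le_t. Qed.

Lemma results_rcons (x : I -> K) s op :
  results x (rcons s op) = rcons (results x s) (operation_val x (results x s) op).
Proof. by rewrite /results foldl_rcons. Qed.

Lemma size_results (x : I -> K) s : size (results x s) = size s.
Proof.
by elim/last_ind: s => // s op IHs; rewrite results_rcons !size_rcons IHs.
Qed.

Lemma operand_val_cat (x : I -> K) r r' o :
  operand_ok (size r) o -> operand_val x (r ++ r') o = operand_val x r o.
Proof. by case: o => //= k lt_k; rewrite nth_cat lt_k. Qed.

End Results.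

Section Substitution.
Variables (K : fieldType) (I J : Type).
Implicit Types (s : seq (operation I)) (q : seq (operation J)).
Variables (sigma : J -> operand I) (m : nat).

(** Relocation of a program placed after [m] operations: its inputs are read through [sigma], its
    own results are shifted by [m]. *)
Definition subst_operand (o : operand J) : operand I :=
  match o with Input j => sigma j | Result k => Result _ (m + k) end.

Definition subst_operation (op : operation J) : operation I :=
  match op with
  | Add o1 o2 => Add (subst_operand o1) (subst_operand o2)
  | Defs.Sub o1 o2 => Defs.Sub (subst_operand o1) (subst_operand o2)
  | Neg o => Neg (subst_operand o)
  | Half o => Half (subst_operand o)
  end.

Hypothesis sigma_ok : forall j, operand_ok m (sigma j).

Lemma subst_operand_ok t o : operand_ok t o -> operand_ok (m + t) (subst_operand o).
Proof.
case: o => [j|k] /=; last by rewrite ltn_add2l.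
by move=> _; apply: operand_ok_leq (sigma_ok j); apply: leq_addr.
Qed.

Lemma subst_operations_ok t q :
  operations_ok t q -> operations_ok (m + t) (map subst_operation q).
Proof.
elim: q t => //= op q IHq t /andP[ok_op /IHq]; rewrite addnS => ->; rewrite andbT.
case: op ok_op => [o1 o2|o1 o2|o|o] /=; try exact: subst_operand_ok;
by case/andP=> /subst_operand_ok-> /subst_operand_ok->.
Qed.

(** A relocated operand has the value it would have in a separate run of [q] on the inputs [y];
    hence the semantics of composition. *)
Lemma results_subst (x : I -> K) s q : size s = m ->
  let y j := operand_val x (results x s) (sigma j) in
  results x (s ++ map subst_operation q) = results x s ++ results y q.
Proof.
move=> size_s y; elim/last_ind: q => [|q op IHq]; first by rewrite !cats0.
have valE o : operand_val x (results x s ++ results y q) (subst_operand o) =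
    operand_val y (results y q) o.
  case: o => [j|k] /=; first by rewrite operand_val_cat // size_results size_s.
  by rewrite nth_cat size_results size_s ltnNge leq_addr addKn.
rewrite map_rcons -rcons_cat !results_rcons IHq -rcons_cat; congr rcons.
by case: op => [o1 o2|o1 o2|o|o] /=; rewrite !valE.
Qed.

End Substitution.

(** * Cost calculus for functions computed by programs *)

Section Computable.
Variable K : fieldType.

(** The program is chosen before the data [x], so one program serves all inputs. *)
Definition computable I J (c : nat) (f : (I -> K) -> J -> K) : Prop :=
  exists P : program I J,
    [/\ well_formed P, (cost P <= c)%N & forall x j, run x P j = f x j].

Lemma eq_computable I J c (f g : (I -> K) -> J -> K) :
  (forall x j, f x j = g x j) -> computable c f -> computable c g.
Proof.
by move=> eq_fg [P [okP leP runP]]; exists P; split=> // x j; rewrite runP.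
Qed.

Lemma computable_leq I J c d (f : (I -> K) -> J -> K) :
  (c <= d)%N -> computable c f -> computable d f.
Proof.
by move=> le_cd [P [okP leP runP]]; exists P; split=> //; apply: leq_trans le_cd.
Qed.

Lemma computable_reindex I J (g : J -> I) : computable 0 (fun x j => x (g j)).
Proof. by exists (Program [::] (fun j => Input (g j))). Qed.

Lemma eq_run I J (P : program I J) (x y : I -> K) : x =1 y -> run x P =1 run y P.
Proof.
move=> eq_xy j; have eq_val r o : operand_val x r o = operand_val y r o by case: o.
rewrite /run eq_val; congr operand_val.
elim/last_ind: (operations P) => // s op IHs; rewrite !results_rcons IHs.
by congr rcons; case: op => [o1 o2|o1 o2|o|o] /=; rewrite !eq_val.
Qed.

Lemma computable_comp I J L c d (f : (I -> K) -> J -> K) (g : (J -> K) -> L -> K) :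
  computable c f -> computable d g -> computable (c + d) (fun x => g (f x)).
Proof.
move=> [P [[okP okPo] leP runP]] [Q [[okQ okQo] leQ runQ]].
pose tr := subst_operand (output P) (cost P).
exists (Program (operations P ++ map (subst_operation (output P) (cost P)) (operations Q))
                (fun l => tr (output Q l))).
have size_cat : size (operations P ++
    map (subst_operation (output P) (cost P)) (operations Q)) = (cost P + cost Q)%N.
  by rewrite size_cat size_map.
split.
- split=> [|l] /=; last by rewrite /cost /= size_cat; apply: subst_operand_ok.
  by rewrite operations_ok_cat okP -[(0 + _)%N]addn0; apply: subst_operations_ok.
- by rewrite /cost /= size_cat leq_add.
move=> x l; rewrite /run /= results_subst //.
rewrite -runQ -(eq_run Q (runP x)) /run /tr.
case: (output Q l) => [j|k] /=; first by rewrite operand_val_cat ?size_results.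
by rewrite nth_cat size_results ltnNge leq_addr addKn.
Qed.

(** The programs run one after the other; relocation with [sigma] equal to [Input] lets each read
    the original inputs. *)
Lemma computable_family I (H : finType) J c (f : H -> (I -> K) -> J -> K) :
  (forall h, computable c (f h)) ->
  computable (#|H| * c) (fun x (hj : H * J) => f hj.1 x hj.2).
Proof.
move=> f_comp.
have [s [out [ok_s le_s outP]]] : exists s (out : H * J -> operand I),
    [/\ operations_ok 0 s, (size s <= #|H| * c)%N &
     forall hj, hj.1 \in enum H -> operand_ok (size s) (out hj) /\
       forall x, operand_val x (results x s) (out hj) = f hj.1 x hj.2].
  rewrite cardE; elim: (enum H) => [|h r [s [out [ok_s le_s outP]]]].
    (* A dummy output: only members of the list treated so far are constrained. *)
    by exists [::], (fun=> Result _ 0).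
  have [Q [[okQ okQo] leQ runQ]] := f_comp h.
  pose tr := subst_operand (@Input I) (size s).
  pose s' := s ++ map (subst_operation (@Input I) (size s)) (operations Q).
  have size_s' : size s' = (size s + cost Q)%N by rewrite size_cat size_map.
  exists s', (fun hj => if hj.1 == h then tr (output Q hj.2) else out hj); split.
  - by rewrite operations_ok_cat ok_s -[(0 + _)%N]addn0; apply: subst_operations_ok.
  - by rewrite size_s' mulSn addnC leq_add.
  move=> [h' j] /=; rewrite inE size_s'.
  have [->|_] := eqVneq h' h => [_|/= /(outP (h', j))[ok_out out_val]].
    split=> [|x]; first exact: subst_operand_ok.
    rewrite results_subst // -runQ /run /tr.
    case: (output Q j) => //= k.
    by rewrite nth_cat size_results ltnNge leq_addr addKn.
  split=> [|x]; first by apply: operand_ok_leq ok_out; apply: leq_addr.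
  by rewrite results_subst // operand_val_cat ?size_results.
have {}outP hj := outP hj (etrans (mem_enum _ _) isT).
exists (Program s out); split=> // [|x hj]; last exact: (outP hj).2.
by split=> //= hj; exact: (outP hj).1.
Qed.

Lemma computable_pointwise I (J : finType) (f : (I -> K) -> J -> K) :
  (forall j, computable 1 (fun x (_ : unit) => f x j)) -> computable #|J| f.
Proof.
move=> f_comp; rewrite -[#|J|]muln1 -[(_ * 1)%N]addn0.
exact: computable_comp (computable_family f_comp)
  (computable_reindex (fun j : J => (j, tt))).
Qed.

(** A copy is free, but charging 1 fits [computable_pointwise] in passes that mix copies with sign
    changes. *)
Lemma computable_input I (i : I) : computable 1 (fun x (_ : unit) => x i).
Proof. exact: computable_leq (computable_reindex (fun=> i)). Qed.

Lemma computable_add I (i j : I) : computable 1 (fun x (_ : unit) => x i + x j).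
Proof. by exists (Program [:: Add (Input i) (Input j)] (fun=> Result _ 0)). Qed.

Lemma computable_sub I (i j : I) : computable 1 (fun x (_ : unit) => x i - x j).
Proof. by exists (Program [:: Defs.Sub (Input i) (Input j)] (fun=> Result _ 0)). Qed.

Lemma computable_neg I (i : I) : computable 1 (fun x (_ : unit) => - x i).
Proof. by exists (Program [:: Neg (Input i)] (fun=> Result _ 0)). Qed.

Lemma computable_half I (i : I) : computable 1 (fun x (_ : unit) => x i / 2%:R).
Proof. by exists (Program [:: Half (Input i)] (fun=> Result _ 0)). Qed.

End Computable.

(** * The fast transforms and their cost *)

Section Transforms.
Variable K : fieldType.

(* Row true, column c holds the difference of the entries whose sum is in row *)
(* false, column ~~ c. This one map takes the components A_bc to the four     *)
(* block arguments of F_n and, up to a factor 2, the latter back to the A_bc. *)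
Definition butterfly J (y : bool * bool * J -> K) (t : bool * bool * J) : K :=
  let u := y (false, t.1.1 (+) t.1.2, t.2) in
  let v := y (true, ~~ (t.1.1 (+) t.1.2), t.2) in
  if t.1.1 then u - v else u + v.

Lemma computable_butterfly (J : finType) :
  computable #|{: bool * bool * J}| (@butterfly J).
Proof.
apply: computable_pointwise => -[[b c] j]; rewrite /butterfly /=.
by case: b; [apply: computable_sub | apply: computable_add].
Qed.

Variable n : nat.
Let coeffs := (bool * bool * {set gen n})%type.

Definition parity_right (y : coeffs -> K) (t : coeffs) : K :=
  if t.1.2 && odd #|t.2| then - y t else y t.

Lemma computable_parity_right : computable #|{: coeffs}| parity_right.
Proof.
apply: computable_pointwise => t; rewrite /parity_right.
by case: (_ && _); [apply: computable_neg | apply: computable_input].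
Qed.

Lemma parity_rightE y b c S : parity_right y (b, c, S) =
  bcoef ((if c then @parity K n else id) (of_bcoef (fun S => y (b, c, S)))) S.
Proof.
rewrite /parity_right /=; case: c; rewrite ?bcoef_parity bcoefE //=.
by rewrite -signr_odd; case: odd; rewrite (expr0, expr1) (mul1r, mulN1r).
Qed.

Lemma card_coeffs : #|{: coeffs}| = (4 ^ n.+1)%N.
Proof.
have card_sets (T : finType) : #|{: {set T}}| = (2 ^ #|T|)%N.
  by rewrite -[LHS]cardsT -powersetT card_powerset cardsT.
by rewrite !card_prod card_bool card_sets card_prod card_ord card_bool expnS
  (mulnC n) expnM.
Qed.

End Transforms.

Lemma computable_fmap (K : fieldType) n :
  computable (2 * (n * 4 ^ n)) (fun (x : {set gen n} -> K)
    (ij : 'I_(2 ^ n) * 'I_(2 ^ n)) => fmap K n (of_bcoef x) ij.1 ij.2).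
Proof.
elim: n => [|n IHn].
  apply: eq_computable (computable_reindex K (fun=> set0)) => x ij.
  by rewrite mxE bcoefE.
pose split_blade (t : bool * bool * {set gen n}) := ext_blade t.1.1 t.1.2 t.2.
pose split_index (ij : 'I_(2 ^ n.+1) * 'I_(2 ^ n.+1)) :=
  let i := index_half ij.1 in let j := index_half ij.2 in ((i.1, j.1), (i.2, j.2)).
have recurse (h : bool * bool) := computable_comp
  (computable_reindex K (fun S : {set gen n} => (h, S))) IHn.
(* Relabellings are free; the butterfly and the sign pass cost 4^(n+1) each, and the four calls 4 *
   2 n 4^n, which add up to exactly 2 (n+1) 4^(n+1). *)
have := computable_comp (computable_comp (computable_comp (computable_comp
  (computable_reindex K split_blade) (@computable_butterfly K _))
  (@computable_parity_right K n)) (computable_family recurse))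
  (computable_reindex K split_index).
rewrite !card_coeffs card_prod card_bool => /(computable_leq _) comp.
apply: eq_computable (comp _ _) => [x [i j]|]; last by rewrite !expnS; lia.
rewrite /= block_pow2E /=.
by case: (index_half i) (index_half j) => [[] k] [[] l] /=;
  congr (fmap K n _ _ _); apply/bcoefP=> S;
  rewrite bcoefE parity_rightE /= ?bcoef_parity bcoefE /butterfly /= ?bcoef_parity
    ?(bcoefD, bcoefN) !bcoefE.
Qed.

Lemma computable_fmap_inv (K : fieldType) n :
  computable (3 * (n * 4 ^ n))
    (fun (x : 'I_(2 ^ n) * 'I_(2 ^ n) -> K) (S : {set gen n}) =>
      bcoef (fmap_inv K n (\matrix_(i, j) x (i, j))) S).
Proof.
elim: n => [|n IHn].
  apply: eq_computable (computable_reindex K (fun=> (ord0, ord0))) => x S.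
  by rewrite bcoefE mxE.
pose join_index (t : (bool * bool) * ('I_(2 ^ n) * 'I_(2 ^ n))) :=
  (half_index t.1.1 t.2.1, half_index t.1.2 t.2.2).
have recurse (h : bool * bool) := computable_comp
  (computable_reindex K (fun ij : 'I_(2 ^ n) * 'I_(2 ^ n) => (h, ij))) IHn.
have halve := computable_pointwise (fun t : bool * bool * {set gen n} =>
  computable_half K t).
(* The forward pipeline reversed, with the same sign pass and butterfly; the extra halving pass
   raises the factor from 2 to 3. *)
have := computable_comp (computable_comp (computable_comp (computable_comp
  (computable_comp (computable_reindex K join_index) (computable_family recurse))
  (@computable_parity_right K n)) (@computable_butterfly K _)) halve)
  (computable_reindex K (@unext_blade n)).
rewrite !card_coeffs card_prod card_bool => /(computable_leq _) comp.
apply: eq_computable (comp _ _) => [x U|]; last by rewrite !expnS; lia.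
have quarterE b c : \matrix_(i, j) x (join_index ((b, c), (i, j))) =
    mx_quarter b c (\matrix_(i, j) x (i, j)).
  by apply/matrixP=> i j; rewrite !mxE.
rewrite /= -[in RHS](unext_bladeK U); case: (unext_blade U) => [[b c] S] /=.
rewrite bcoef_assemble mulrC /butterfly /=.
by case: b; case: c;
  rewrite !parity_rightE /= bcoefZ bcoefD ?bcoefN !(bcoef_parity, bcoefE) /= !quarterE.
Qed.

Theorem mainTheorem2 :
  exists C : nat, forall K : fieldType, 2%N \notin [pchar K] ->
    (forall n : nat,
       [/\ linear (fmap K n), monoid_morphism (fmap K n) & bijective (fmap K n)])
    /\
    (forall n : nat, (0 < n)%N ->
       (exists P : program {set gen n} ('I_(2 ^ n) * 'I_(2 ^ n)),
          [/\ well_formed P,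
              (cost P <= C * (n * 4 ^ n))%N
            & forall (a : Clifford K n) (i j : 'I_(2 ^ n)),
                run (fun S => bcoef a S) P (i, j) = fmap K n a i j])
       /\
       (forall G : 'M[K]_(2 ^ n) -> Clifford K n,
          cancel (fmap K n) G -> cancel G (fmap K n) ->
          exists Q : program ('I_(2 ^ n) * 'I_(2 ^ n)) {set gen n},
            [/\ well_formed Q,
                (cost Q <= C * (n * 4 ^ n))%N
              & forall (M : 'M[K]_(2 ^ n)) (S : {set gen n}),
                  run (fun ij => M ij.1 ij.2) Q S = bcoef (G M) S])).
Proof.
(* The larger of the factors 2 (forward) and 3 (inverse). *)
exists 3%N => K char2; split=> [n|n _].
  split; [exact: fmap_is_linear | exact: fmap_is_monoid_morphism | exact: fmap_bij].
split=> [|G fmapG _].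
  have [P [okP le_cost runP]] := computable_fmap K n.
  exists P; split=> // [|a i j];
    first by apply: leq_trans le_cost _; rewrite leq_mul2r orbT.
  rewrite runP; congr (fmap K n _ _ _).
  by apply/bcoefP=> S; rewrite bcoefE.
have [Q [okQ le_cost runQ]] := computable_fmap_inv K n.
(* Writing M as the image of [fmap_inv K n M] shows that any left inverse [G] agrees with
   [fmap_inv]. *)
exists Q; split=> // M S; rewrite runQ -[in RHS](fmap_invK char2 M) fmapG.
by congr (bcoef (fmap_inv K n _) S); apply/matrixP=> i j; rewrite mxE.
Qed.
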